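(* Let $d\in\mathbb{N}$, let $\mathcal{X}\subset\mathbb{R}^d$ be an open subset, and let $k:\mathcal{X}\times\mathcal{X}\to\mathbb{R}$ be a symmetric positive definite kernel which is twice continuously differentiable in both variables, with $k(x,x)>0$ for all $x\in\mathcal{X}$ and $$D_k^2:=\sup_{\substack{(x,y)\in\mathcal{X}\times\mathcal{X}\\1\le i,j\le d}}\max\bigl\{|\partial_{x_i}\partial_{y_j}k^2(x,y)|,\,|\partial_{x_i}\partial_{y_j}k(x,y)|,\,|\partial_{x_i}k(x,y)|,\,|\partial_{y_j}k(x,y)|,\,|k(x,y)|\bigr\}<\infty.$$ Let $A\in\mathcal{C}^1(\mathcal{X},\mathbb{R})$ and $\lambda>0$. Then for any $x,y\in\mathcal{X}$ and $\mu,\nu\in\mathcal{P}_2(\mathcal{X}\times\mathcal{X})$, $$|m^\lambda_A(x;\mu)-m^\lambda_A(y;\nu)|\le C_1\,\mathbb{W}_1(\mu,\nu)+C_2\,|x-y|,$$ where $$C_1:=\Bigl(\frac{D_k}{\lambda^2}+\frac1\lambda\Bigr)d\,D_k^2\,\|A\|_{\mathcal{C}^1},\qquad C_2:=\frac{\sqrt d}{\lambda}D_k^2\,\|A\|_{\mathcal{C}^1}.$$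
   Context: A symmetric kernel $k:\mathcal{X}\times\mathcal{X}\to\mathbb{R}$ is called positive definite if $\sum_{i,j=1}^n c_ic_jk(x_i,x_j)\ge 0$ for all $n$, $c_i\in\mathbb{R}$, $x_i\in\mathcal{X}$. Its reproducing kernel Hilbert space (RKHS) $\mathcal{H}$ is the unique Hilbert space of functions $f:\mathcal{X}\to\mathbb{R}$ containing all $k(x,\cdot)$ and satisfying $f(x)=\langle f,k(x,\cdot)\rangle_{\mathcal{H}}$ for all $f\in\mathcal{H}$, $x\in\mathcal{X}$. $D_k\geq 0$ denotes the square root of $D_k^2$, and $k^2(x,y)=(k(x,y))^2$. $\mathcal{C}^1(\mathcal{X},\mathbb{R})$ is the space of all functions $f:\mathcal{X}\to\mathbb{R}$ with $\|f\|_{\mathcal{C}^1}:=\sup_{x\in\mathcal{X}}|f(x)|+\sup_{x\in\mathcal{X},\,i=1,\dots,d}|\partial_{x_i}f(x)|<\infty$. $\mathcal{P}_2(\mathcal{X}\times\mathcal{X})$ is the set of Borel probability measures on $\mathcal{X}\times\mathcal{X}$ with finite second moment, and $\mathbb{W}_1(\mu,\nu):=\inf\mathsf{E}|U-V|$, the infimum being over all pairs of random variables with $\mathrm{Law}(U)=\mu$, $\mathrm{Law}(V)=\nu$ (Euclidean norm). For $\nu\in\mathcal{P}_2(\mathcal{X}\times\mathcal{X})$ and $\lambda>0$, $m^\lambda_A(\cdot;\nu)\in\mathcal{H}$ is the (unique) minimizer $$m^\lambda_A(\cdot;\nu):=\mathop{\mathrm{arg\,min}}_{f\in\mathcal{H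}}\Bigl\{\int_{\mathcal{X}\times\mathcal{X}}|A(y)-f(x)|^2\,\nu(dx,dy)+\lambda\|f\|_{\mathcal{H}}^2\Bigr\}.$$
   Formalization: The open set X is additionally assumed convex: for arbitrary open X the claim fails, e.g. X = R\{0}, k(x,y) = sgn(x)sgn(y), A = 1, λ = 1, μ = ν = Dirac at (1,1), x = 1/4, y = -1/4, where the left side is 1 and the right side 1/2. *)

(* Defs.v *)
From HB Require Import structures.
From mathcomp Require Import all_boot all_order all_algebra.
From mathcomp Require Import sesquilinear.
From mathcomp Require Import all_classical all_reals all_analysis.

Set Implicit Arguments.
Unset Strict Implicit.
Unset Printing Implicit Defensive.

Import Order.TTheory GRing.Theory Num.Theory.
Import numFieldNormedType.Exports.

Local Open Scope classical_set_scope.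
Local Open Scope ring_scope.

(* Points of R^d are row vectors.  The library norm on 'rV[R]_d is the sup
   norm, so the Euclidean one is defined here; both induce the same topology. *)
Section Euclidean.
Context {R : realType} {d : nat}.

Definition enorm (v : 'rV[R]_d) : R := Num.sqrt (\sum_i v 0 i ^+ 2).

Definition enorm2 (z : 'rV[R]_d * 'rV[R]_d) : R :=
  Num.sqrt (enorm z.1 ^+ 2 + enorm z.2 ^+ 2).

End Euclidean.

(* Functions on the open set X are total functions, of which only the values
   on X are ever used: X being open, a derivative at a point of X depends only
   on these values. *)
Section Smoothness.
Context {R : realType} {d : nat}.
Notation E := 'rV[R]_d.

Definition pd (i : 'I_d) (f : E -> R) : E -> R :=
  fun x => 'D_(delta_mx 0 i) f x.

Definition pdx (i : 'I_d) (k : E -> E -> R) : E -> E -> R :=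
  fun x y => pd i (k ^~ y) x.

Definition pdy (j : 'I_d) (k : E -> E -> R) : E -> E -> R :=
  fun x y => pd j (k x) y.

Definition kcontinuous (X : set E) (k : E -> E -> R) :=
  forall x y, X x -> X y -> {for (x, y), continuous (fun z => k z.1 z.2)}.

Definition kC1 (X : set E) (k : E -> E -> R) :=
  kcontinuous X k /\
  forall i : 'I_d,
    [/\ forall x y, X x -> X y -> derivable (k ^~ y) x (delta_mx 0 i),
        forall x y, X x -> X y -> derivable (k x) y (delta_mx 0 i),
        kcontinuous X (pdx i k) & kcontinuous X (pdy i k)].

Definition kC2 (X : set E) (k : E -> E -> R) :=
  kC1 X k /\ forall i : 'I_d, kC1 X (pdx i k) /\ kC1 X (pdy i k).

Definition Dk_sq (X : set E) (k : E -> E -> R) : \bar R :=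
  ereal_sup [set t | exists x y (i j : 'I_d), [/\ X x, X y &
    t = (Num.max `|pdx i (pdy j (fun u v => k u v ^+ 2)) x y|
        (Num.max `|pdx i (pdy j k) x y|
        (Num.max `|pdx i k x y|
        (Num.max `|pdy j k x y| `|k x y|))))%:E]].

Definition Dk (X : set E) (k : E -> E -> R) : R := Num.sqrt (fine (Dk_sq X k)).

Definition C1norm (X : set E) (f : E -> R) : \bar R :=
  (ereal_sup [set t | exists2 x, X x & t = `|f x|%:E] +
   ereal_sup [set t | exists x (i : 'I_d), X x /\ t = `|pd i f x|%:E])%E.

(* Membership in C^1(X, R) asks for no more than the finiteness of the norm:
   the partial derivatives exist and are bounded. *)
Definition C1space (X : set E) (f : E -> R) :=
  (forall x (i : 'I_d), X x -> derivable f x (delta_mx 0 i)) /\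
  (C1norm X f < +oo)%E.

End Smoothness.

Section Kernels.
Context {R : realType} {T : Type}.

Definition symmetric_kernel (X : set T) (k : T -> T -> R) :=
  forall x y, X x -> X y -> k x y = k y x.

Definition posdef_kernel (X : set T) (k : T -> T -> R) :=
  forall n (c : 'I_n -> R) (x : 'I_n -> T), (forall i, X (x i)) ->
    0 <= \sum_(i < n) \sum_(j < n) c i * c j * k (x i) (x j).

(* A Hilbert space is a complete normed module whose norm comes from an inner
   product; [rkhs_eval] reads its elements as functions on X, and is injective
   because two functions that agree on X are equal. *)
Record rkhs (X : set T) (k : T -> T -> R) := Rkhs {
  rkhs_space :> completeNormedModType R;
  rkhs_dot : {dot rkhs_space for idfun};
  rkhs_eval : rkhs_space -> T -> R;
  rkhs_normE : forall f, `|f| ^+ 2 = rkhs_dot f f;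
  rkhs_linear : forall a f g x, X x ->
    rkhs_eval (a *: f + g) x = a * rkhs_eval f x + rkhs_eval g x;
  rkhs_inj : forall f g,
    (forall x, X x -> rkhs_eval f x = rkhs_eval g x) -> f = g;
  rkhs_reproducing : forall x, X x -> exists kx : rkhs_space,
    (forall y, X y -> rkhs_eval kx y = k x y) /\
    (forall f, rkhs_eval f x = rkhs_dot f kx)
}.

End Kernels.

Section Measures.
Context {R : realType} {d : nat}.
Notation E := 'rV[R]_d.

Definition borel2 := g_sigma_algebraType (@open (E * E)%type).

(* A Borel probability measure on X x X is one on R^d x R^d that gives full
   measure to the open set X x X. *)
Definition P2 (X : set E) (mu : probability borel2 R) :=
  mu (X `*` X) = 1%E /\ (\int[mu]_z (enorm2 z ^+ 2)%:E < +oo)%E.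

Definition W1 (mu nu : probability borel2 R) : \bar R :=
  ereal_inf [set t | exists (dO : measure_display) (O : measurableType dO)
    (P : probability O R) (U V : {mfun O >-> borel2}),
    [/\ forall B, measurable B -> distribution P U B = mu B,
        forall B, measurable B -> distribution P V B = nu B &
        t = (\int[P]_w (enorm2 ((U w : E * E) - (V w : E * E)))%:E)%E]].

Definition risk (X : set E) (k : E -> E -> R) (H : rkhs X k)
    (A : E -> R) (lambda : R) (nu : probability borel2 R) (f : H) : \bar R :=
  (\int[nu]_(z in X `*` X) (`|A z.2 - rkhs_eval f z.1| ^+ 2)%:E +
   (lambda * `|f| ^+ 2)%:E)%E.

Definition minimizer (X : set E) (k : E -> E -> R) (H : rkhs X k)
    (A : E -> R) (lambda : R) (nu : probability borel2 R) : H :=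
  xget 0 [set f | forall g : H, (risk A lambda nu f <= risk A lambda nu g)%E].

End Measures.

(* Main.v *)
Require Import Defs.
From HB Require Import structures.
From mathcomp Require Import all_boot all_order all_algebra.
From mathcomp Require Import sesquilinear ring lra zify.
From mathcomp Require Import all_classical all_reals all_analysis.
From mathcomp Require Import measurable_realfun.

Set Implicit Arguments.
Unset Strict Implicit.
Unset Printing Implicit Defensive.

Import Order.TTheory GRing.Theory Num.Theory.
Import numFieldNormedType.Exports.
Local Open Scope classical_set_scope.
Local Open Scope ring_scope.

(* The first-order condition at the minimizer m for nu reads
     int (m(x) - A(y)) g(x) dnu + lambda <m, g> = 0   for all g in H;
   taking g = m gives lambda |m| <= D |A|.  For m, n minimizing with respect to
   mu, nu, subtracting the two conditions at g = m - n gives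
     lambda |g|^2 <= int phi dmu - int phi dnu,   phi = (A(y) - n(x)) g(x),
   and phi is Lipschitz: the increments of f in H are bounded by |f| times
   sqrt (k(x,x) - 2 k(x,y) + k(y,y)), those of n g by |n| |g| times the same
   expression for k^2, and both second differences are controlled by the mixed
   derivatives since X is convex.  Every coupling of mu and nu then bounds the
   right-hand side. *)

(** * Real Hilbert spaces *)

Section RealHilbert.
Context {R : realType} {H : completeNormedModType R}.
Variable dot : {dot H for idfun}.
Hypothesis normE : forall f, `|f| ^+ 2 = dot f f.
Implicit Types f g u v : H.

Lemma dotC f g : dot f g = dot g f.
Proof. by rewrite (@hermC _ _ idfun) expr0 mul1r. Qed.

Lemma dotZl a f g : dot (a *: f) g = a * dot f g.
Proof. by rewrite linearZl_LR. Qed.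

Lemma dotZr a f g : dot f (a *: g) = a * dot f g.
Proof. by rewrite dotC dotZl dotC. Qed.

Lemma sqr_normD f g : `|f + g| ^+ 2 = `|f| ^+ 2 + 2 * dot f g + `|g| ^+ 2.
Proof. by rewrite !normE linearDl !linearDr /= (dotC g f); ring. Qed.

Lemma sqr_normB f g : `|f - g| ^+ 2 = `|f| ^+ 2 - 2 * dot f g + `|g| ^+ 2.
Proof. by rewrite sqr_normD normrN linearNr /=; ring. Qed.

Lemma cauchy_schwarz f g : `|dot f g| <= `|f| * `|g|.
Proof.
have [->|g0] := eqVneq g 0; first by rewrite linear0r normr0 mulr_ge0.
have gp : 0 < `|g| by rewrite normr_gt0.
rewrite -(ler_pXn2r (n := 2)) ?nnegrE ?mulr_ge0// real_normK ?num_real// exprMn.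
rewrite -ler_pdivrMr ?exprn_gt0// -subr_ge0.
suff -> : `|f| ^+ 2 - dot f g ^+ 2 / `|g| ^+ 2
    = `|f - (dot f g / `|g| ^+ 2) *: g| ^+ 2 by rewrite exprn_ge0.
rewrite sqr_normB dotZr normrZ exprMn real_normK ?num_real//.
by field; rewrite gt_eqF.
Qed.

(* The right-hand side is the squared norm of [u (x) u - v (x) v] in the Hilbert
   tensor square, i.e. in the RKHS of the squared kernel: this is what brings
   the derivatives of k^2 into the final constant. *)
Lemma dot_mul_diff (n g u v : H) :
  (dot n u * dot g u - dot n v * dot g v) ^+ 2 <=
  (`|n| * `|g|) ^+ 2 * (`|u| ^+ 4 - 2 * dot u v ^+ 2 + `|v| ^+ 4).
Proof.
(* [t] is the operator u tensor u minus v tensor v applied to [g]. After Cauchy-Schwarz against [n],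
   its operator norm has to be bounded by its Hilbert-Schmidt norm. *)
pose t := dot g u *: u - dot g v *: v.
have -> : dot n u * dot g u - dot n v * dot g v = dot n t.
  by rewrite /t linearBr /= !dotZr; ring.
have : dot n t ^+ 2 <= `|n| ^+ 2 * `|t| ^+ 2.
  rewrite -exprMn -(real_normK (num_real (dot n t))).
  by rewrite ler_pXn2r ?nnegrE ?mulr_ge0 ?cauchy_schwarz.
move=> /le_trans; apply.
rewrite exprMn -(mulrA (`|n| ^+ 2)); apply: ler_wpM2l; first exact: exprn_ge0.
rewrite {}/t sqr_normB dotZl dotZr !normrZ !exprMn !real_normK ?num_real//.
set U := `|u| ^+ 2; set V := `|v| ^+ 2; set G := `|g| ^+ 2.
set a := dot g u; set b := dot g v; set w := dot u v.
have -> : `|u| ^+ 4 = U ^+ 2 by rewrite -exprM.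
have -> : `|v| ^+ 4 = V ^+ 2 by rewrite -exprM.
have V0 : 0 <= V by rewrite exprn_ge0.
have bGV : b ^+ 2 <= G * V.
  rewrite -exprMn -(real_normK (num_real b)).
  by rewrite ler_pXn2r ?nnegrE ?mulr_ge0 ?cauchy_schwarz.
have aGU : a ^+ 2 <= G * U.
  rewrite -exprMn -(real_normK (num_real a)).
  by rewrite ler_pXn2r ?nnegrE ?mulr_ge0 ?cauchy_schwarz.
have [u0|un0] := eqVneq u 0.
  have -> : a = 0 by rewrite /a u0 linear0r.
  have -> : U = 0 by rewrite /U u0 normr0 expr0n.
  have -> : w = 0 by rewrite /w u0 linear0l.
  by have := ler_wpM2r V0 bGV; lra.
have Up : 0 < U by rewrite exprn_gt0// normr_gt0.
(* Gram-Schmidt: [v] is [c *: u + v'] with [v'] orthogonal to [u]. *)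
pose c := w / U; pose v' := v - c *: u; pose q := `|v'| ^+ 2.
pose b' := dot g v'.
have wE : w = c * U by rewrite /c divfK// gt_eqF.
have bE : b = b' + c * a by rewrite /b' /v' linearBr /= dotZr -/a -/b; ring.
have ortho : dot u v' = 0.
  by rewrite /v' linearBr /= dotZr -normE -/U -/w wE; ring.
have VE : V = c ^+ 2 * U + q.
  rewrite /V (_ : v = c *: u + v'); last by rewrite /v' addrC subrK.
  rewrite sqr_normD dotZl ortho normrZ exprMn real_normK ?num_real//.
  by rewrite -/U -/q; ring.
rewrite {1 2}bE wE VE; set p := 1 - c ^+ 2.
have [v'0|v'n0] := eqVneq v' 0.
  have -> : q = 0 by rewrite /q v'0 normr0 expr0n.
  have -> : b' = 0 by rewrite /b' v'0 linear0r.
  have P0 : 0 <= U * p ^+ 2 by rewrite mulr_ge0 ?sqr_ge0// ltW.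
  by have := ler_wpM2l P0 aGU; rewrite /p; lra.
have qp : 0 < q by rewrite exprn_gt0// normr_gt0.
(* Bessel's inequality for [g] against the orthogonal pair [u], [v']: the defect is the squared
   distance from [g] to its projection on their span. *)
have Gram : a ^+ 2 / U + b' ^+ 2 / q <= G.
  rewrite -subr_ge0 (_ : G - _ = `|g - ((a / U) *: u + (b' / q) *: v')| ^+ 2).
    exact: exprn_ge0.
  rewrite sqr_normB sqr_normD linearDr /= !dotZr dotZl ortho !normrZ !exprMn.
  rewrite !real_normK ?num_real// -/a -/b' -/U -/q -/G.
  by field; rewrite ?gt_eqF.
set S := (X in _ <= _ * X).
have SE : S = p ^+ 2 * U ^+ 2 + 2 * c ^+ 2 * U * q + q ^+ 2.
  by rewrite /S /p; ring.
have S0 : 0 <= S.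
  rewrite SE -exprMn !addr_ge0 ?sqr_ge0//.
  have cc := sqr_ge0 c; have U0 := ltW Up; have q0 := ltW qp.
  by rewrite (mulr_ge0 (mulr_ge0 (mulr_ge0 _ cc) U0) q0).
apply: le_trans (ler_wpM2r S0 Gram); rewrite SE -subr_ge0.
(* Once [G] is replaced by its Bessel bound, the gap is a sum of two squares. *)
have -> : (a ^+ 2 / U + b' ^+ 2 / q) *
    (p ^+ 2 * U ^+ 2 + 2 * c ^+ 2 * U * q + q ^+ 2) -
    (a ^+ 2 * U - 2 * (a * ((b' + c * a) * (c * U))) +
     (b' + c * a) ^+ 2 * (c ^+ 2 * U + q)) =
    (a * q - b' * c * U) ^+ 2 / U + (a * c * q + b' * p * U) ^+ 2 / q.
  by rewrite /p; field; rewrite ?gt_eqF.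
by rewrite addr_ge0// divr_ge0 ?sqr_ge0// ltW.
Qed.

(** Direct method: the lower bound on [Q] is strong convexity, so minimizing sequences are Cauchy
    and converge by completeness. At the limit the bound on [B] controls the linear term, and [Q] is
    nonnegative. *)
Lemma quadratic_minimizer (J Q : H -> R) (B : H -> H -> R) (lambda : R) :
  0 < lambda ->
  (forall f, 0 <= J f) ->
  (forall f g, J (f + g) = J f + 2 * B f g + Q g) ->
  (forall a f g, B f (a *: g) = a * B f g) ->
  (forall a g, Q (a *: g) = a ^+ 2 * Q g) ->
  (forall g, lambda * `|g| ^+ 2 <= Q g) ->
  (forall f, exists2 C, 0 <= C & forall g, `|B f g| <= C * `|g|) ->
  exists m, forall g, J m <= J g.
Proof.
move=> lam0 J0 JD BZ QZ Qlam Bbd.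
have Q0 g : 0 <= Q g by apply: le_trans (Qlam g); rewrite mulr_ge0 ?exprn_ge0 ?(ltW lam0).
pose s := inf (range J).
have hinf : has_inf (range J).
  by split; [exists (J 0), 0 | exists 0 => _ [f _ <-]].
have sle f : s <= J f by apply: ge_inf; [exact: hinf.2 | exists f].
have /choice[u uP] (n : nat) : exists f, J f < s + n.+1%:R^-1.
  have [|_ [f _ <-] fs] := @inf_adherent _ _ n.+1%:R^-1 _ hinf; last by exists f.
  by rewrite invr_gt0.
(* With midpoint [c] and half-difference [h], the mean of [J f] and [J g] is [J c + Q h], where
   [J c] is at least the infimum [s]. *)
have parallelogram f g : lambda / 4 * `|f - g| ^+ 2 <= (J f + J g) / 2 - s.
  pose c := 2^-1 *: (f + g); pose h := 2^-1 *: (f - g).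
  have half x : 2^-1 *: (x + x) = x :> H.
    by rewrite scalerDr -scalerDl (_ : 2^-1 + 2^-1 = 1) ?scale1r//; lra.
  have fE : f = c + h by rewrite -scalerDr addrACA subrr addr0 half.
  have gE : g = c + (-1) *: h.
    by rewrite scaleN1r -scalerBr opprB addrC addrA subrK half.
  have Jf : J f = J c + 2 * B c h + Q h by rewrite -JD -fE.
  have Jg : J g = J c - 2 * B c h + Q h by rewrite [in LHS]gE JD BZ QZ; ring.
  have := sle c; have := Qlam h; rewrite Jf Jg.
  rewrite /h normrZ exprMn real_normK ?num_real//.
  by lra.
have u_cvg : cvg (u @ \oo).
  apply: cauchy_cvg; apply: cauchy_exP => e e0.
  have e'0 : 0 < lambda / 4 * e ^+ 2 by rewrite !mulr_gt0 ?exprn_gt0.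
  have [N _ Ne] := near_infty_natSinv_lt (PosNum e'0).
  have {}Ne k : (N <= k)%N -> k.+1%:R^-1 < lambda / 4 * e ^+ 2 := Ne k.
  exists (u N); exists N => // n /= Nn.
  rewrite -ball_normE /= -(ltr_pXn2r (n := 2)) ?nnegrE// ?(ltW e0)//.
  rewrite -(ltr_pM2l (x := lambda / 4)) ?divr_gt0//.
  apply: le_lt_trans (parallelogram _ _) _.
  have := Ne _ Nn; have := Ne N (leqnn N).
  by have := uP n; have := uP N; move: (n.+1%:R^-1) (N.+1%:R^-1) => ? ?; lra.
exists (lim (u @ \oo)) => g; apply: le_trans (sle g).
set m := lim _; have [C C0 mC] := Bbd m.
apply/ler_addgt0Pr => e e0.
(* Expanding [J (u n)] around [m], half of [e] pays for its excess over [s], half for the linear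
   term [2 * B]. [C + 1] keeps the denominator positive when [C] is 0. *)
have C1 : 0 < 4 * (C + 1) by lra.
have e1 : 0 < e / (4 * (C + 1)) by rewrite divr_gt0.
have e2 : 0 < e / 2 by rewrite divr_gt0.
have /cvgrPdist_lt /(_ _ e1) [N1 _ Nm] : u @ \oo --> m by [].
have [N2 _ Ne] := near_infty_natSinv_lt (PosNum e2).
have {}Ne k : (N2 <= k)%N -> k.+1%:R^-1 < e / 2 := Ne k.
have {}Nm k : (N1 <= k)%N -> `|m - u k| < e / (4 * (C + 1)) := Nm k.
have := Nm _ (leq_maxl N1 N2); have := Ne _ (leq_maxr N1 N2).
set n := maxn _ _ => ne nm.
have : J (u n) = J m + 2 * B m (u n - m) + Q (u n - m) by rewrite -JD addrC subrK.
have : `|B m (u n - m)| <= C * (e / (4 * (C + 1))).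
  by apply: le_trans (mC _) _; rewrite ler_wpM2l// distrC ltW.
have : C * (e / (4 * (C + 1))) <= e / 4.
  rewrite mulrA ler_pdivrMr// -subr_ge0 (_ : _ - _ = e); first exact: ltW.
  by field.
have := Q0 (u n - m); have := uP n; rewrite ler_norml => + + + /andP[].
by move: ne; move: (n.+1%:R^-1) => ?; lra.
Qed.
End RealHilbert.

(** Turns minimality along a line into a first-order condition. *)
Lemma linear_term_eq0 {R : realType} (b q : R) :
  0 <= q -> (forall t, 0 <= 2 * (t * b) + t ^+ 2 * q) -> b = 0.
Proof.
(* The optimal test value is -b/q; [q + 1] also covers [q = 0] and still makes the expression
   negative unless [b = 0]. *)
move=> q0 /(_ (- (b / (q + 1)))).
have q1 : 0 < q + 1 by lra.
rewrite (_ : _ + _ = - (b ^+ 2 * ((q + 2) / (q + 1) ^+ 2))); last first.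
  by field; rewrite gt_eqF.
rewrite oppr_ge0 pmulr_lle0; last by rewrite divr_gt0 ?exprn_gt0//; lra.
by move=> b2; apply/eqP; rewrite -sqrf_eq0 eq_le b2 sqr_ge0.
Qed.

(** * Increments of functions with bounded partial derivatives *)

Lemma derivable_line {R : realType} {V : normedModType R} (f : V -> R)
    (z e : V) (t : R) :
  derivable f (z + t *: e) e ->
  is_derive t 1 (fun s => f (z + s *: e)) ('D_e f (z + t *: e)).
Proof.
move=> fe.
have quotE : (fun h : R => h^-1 *: (((fun s => f (z + s *: e)) \o shift t) (h *: 1) -
      f (z + t *: e)))
    = (fun h : R => h^-1 *: ((f \o shift (z + t *: e)) (h *: e) - f (z + t *: e))).
  apply/funext => h /=; congr (_ *: (f _ - _)).
  by rewrite /shift /= scalerDl addrCA [h *: 1]mulr1.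
by split; rewrite /derivable /derive quotE.
Qed.

Lemma line_increment_le {R : realType} {V : normedModType R} (f : V -> R)
    (z e : V) (c M : R) :
  (forall t, Num.min 0 c <= t <= Num.max 0 c ->
     derivable f (z + t *: e) e /\ `|'D_e f (z + t *: e)| <= M) ->
  `|f (z + c *: e) - f z| <= M * `|c|.
Proof.
pose F t := f (z + t *: e) => bnd.
have FE a b : a <= b -> (forall t, t \in `[a, b] ->
    derivable f (z + t *: e) e /\ `|'D_e f (z + t *: e)| <= M) ->
    `|F b - F a| <= M * (b - a).
  move=> ab abP.
  pose dF (t : R) : R := 'D_e f (z + t *: e).
  have dFP (t : R) : t \in `[a, b] -> is_derive t (1 : R) F (dF t).
    by move=> /abP[fd _]; exact: derivable_line.
  have Fcont : {within `[a, b], continuous F}.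
    by apply: derivable_within_continuous => t /dFP [].
  have Fder (t : R) : t \in `]a, b[ -> is_derive t (1 : R) F (dF t).
    by move=> tab; apply: dFP; exact: subset_itv_oo_cc.
  have [t tab FE] := MVT_segment ab Fder Fcont.
  rewrite FE normrM (ger0_norm (x := b - a)) ?subr_ge0// ler_wpM2r ?subr_ge0//.
  by case: (abP t tab).
have F0 : F 0 = f z by rewrite /F scale0r addr0.
rewrite -F0 -/(F c). have [c0|/ltW c0] := leP 0 c.
  rewrite (ger0_norm c0) -{2}(subr0 c); apply: FE => // t; rewrite in_itv /= => tc.
  by apply: bnd; rewrite (min_idPl c0) (max_idPr c0).
rewrite (ler0_norm c0) distrC -(sub0r c); apply: FE => // t; rewrite in_itv /= => tc.
by apply: bnd; rewrite (min_idPr c0) (max_idPl c0).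
Qed.

Definition l1norm {R : realType} {d : nat} (v : 'rV[R]_d) : R := \sum_i `|v 0 i|.

Section BoundedPartials.
Context {R : realType} {d : nat}.
Notation E := 'rV[R]_d.
Implicit Types (X : set E) (f : E -> R) (x y : E).

(** Only partial derivatives are at hand, so [x] is changed into [y] one coordinate at a time. A
    sup-norm ball is a product of intervals and contains every intermediate point. *)
Lemma ball_increment_le f x y (r M : R) : 0 <= M ->
  (forall z, ball x r z -> forall i : 'I_d,
     derivable f z (delta_mx 0 i) /\ `|pd i f z| <= M) ->
  ball x r y -> `|f y - f x| <= M * l1norm (y - x).
Proof.
move=> M0 bnd xy.
have xx : ball x r x.
  case: xy => r0 _; exact: ballxx.
pose h m : E := \row_i (if (i < m)%N then y 0 i else x 0 i).
have step m : (m <= d)%N ->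
    `|f (h m) - f x| <= M * \sum_(i < d | (i < m)%N) `|(y - x) 0 i|.
  elim: m => [_|m IH md].
    rewrite (_ : h 0%N = x) ?subrr ?normr0 ?mulr_ge0 ?sumr_ge0//.
    by apply/rowP => i; rewrite mxE.
  pose j : 'I_d := Ordinal md.
  rewrite (bigD1 j) //= mulrDr.
  have -> : \sum_(i < d | (i < m.+1)%N && (i != j)) `|(y - x) 0 i| =
            \sum_(i < d | (i < m)%N) `|(y - x) 0 i|.
    by apply: eq_bigl => i; rewrite -val_eqE /=; lia.
  rewrite -(subrK (f (h m)) (f (h m.+1))) -addrA.
  apply: le_trans (ler_normD _ _) _; apply: lerD; last exact: IH (ltnW md).
  have -> : h m.+1 = h m + ((y - x) 0 j) *: delta_mx 0 j.
    apply/rowP => i; rewrite !mxE eqxx /= -val_eqE /=.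
    case: (ltngtP i m) => [im|im|im].
    - by rewrite ltnS ltnW //= mulr0 addr0.
    - by rewrite ltnS leqNgt im /= mulr0 addr0.
    - have -> : i = j by apply/val_inj.
      by rewrite /= ltnSn mulr1 addrC subrK.
  apply: line_increment_le => t tI; apply: bnd.
  split; first by case: xy.
  move=> i0 i; rewrite ord1 !mxE eqxx /= -val_eqE /=.
  have ball_i (a b : R) : Num.min 0 ((y - x) 0 j) <= a <= Num.max 0 ((y - x) 0 j) ->
      ball (x 0 j) r (x 0 j + a).
    have := xy.2 0 j; rewrite !mxE -!ball_normE /= !ltr_norml.
    by case: (leP 0 (y 0 j - x 0 j)) => ?; lra.
  case: (ltngtP i m) => [im|im|im].
  - by rewrite mulr0 addr0; exact: xy.2.
  - by rewrite mulr0 addr0; exact: xx.2.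
  - have -> : i = j by apply/val_inj.
    by rewrite mulr1; apply: ball_i.
have := step d (leqnn d).
rewrite (_ : h d = y); last by apply/rowP => i; rewrite mxE ltn_ord.
by rewrite /l1norm (eq_bigl xpredT)// => i; rewrite ltn_ord.
Qed.

Lemma l1norm_ge0 x : 0 <= l1norm x.
Proof. exact: sumr_ge0. Qed.

Lemma l1normZ a x : l1norm (a *: x) = `|a| * l1norm x.
Proof. by rewrite /l1norm mulr_sumr; apply: eq_bigr => i _; rewrite mxE normrM. Qed.

Lemma convex_segment X x y t : convex_set (X : set (convex_lmodType E)) ->
  X x -> X y -> 0 <= t <= 1 -> X (x + t *: (y - x)).
Proof.
move=> cX Xx Xy /andP[t0 t1].
have t01 : Itv.spec (@Itv.num_sem R) (Itv.Real `[0%Z, 1%Z]) t.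
  by rewrite /Itv.spec /= /Itv.num_sem /= num_real in_itv /= t0 t1.
have := cX y x (Itv.mk t01); rewrite !inE => /(_ Xy Xx).
by rewrite /conv /= /unstable.onem scalerBl scale1r scalerBr addrCA.
Qed.

(** The segment from [x] to [y] stays in the convex set, while coordinatewise paths may leave it.
    The ball estimate is applied to short pieces of the segment; nothing is lost in joining them,
    since [l1norm] is additive along a segment. *)
Lemma increment_le X f x y (M : R) :
  open X -> convex_set (X : set (convex_lmodType E)) -> 0 <= M ->
  (forall z i, X z -> derivable f z (delta_mx 0 i)) ->
  (forall z i, X z -> `|pd i f z| <= M) ->
  X x -> X y -> `|f y - f x| <= M * l1norm (y - x).
Proof.
move=> oX cX M0 df fM Xx Xy.
pose p t : E := x + t *: (y - x).
pose C := M * l1norm (y - x).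
have C0 : 0 <= C by rewrite mulr_ge0// l1norm_ge0.
have pX t : 0 <= t <= 1 -> X (p t) by exact: convex_segment.
have local t : 0 <= t <= 1 -> exists2 e, 0 < e &
    forall s, `|s - t| < e -> `|f (p s) - f (p t)| <= C * `|s - t|.
  move=> t01; have /nbhs_ballP [r /= r0 rX] := open_nbhs_nbhs (conj oX (pX t t01)).
  have n0 : 0 < `|y - x| + 1 by rewrite ltr_wpDl.
  exists (r / (`|y - x| + 1)); first by rewrite divr_gt0.
  move=> s st.
  have pE : p s - p t = (s - t) *: (y - x).
    by rewrite /p opprD addrACA subrr add0r scalerBl.
  have -> : C * `|s - t| = M * l1norm (p s - p t) by rewrite pE l1normZ /C; ring.
  apply: (@ball_increment_le f (p t) (p s) r) => //.
    by move=> z /rX Xz i; split; [exact: df|exact: fM].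
  rewrite -ball_normE /= distrC pE normrZ.
  apply: le_lt_trans (_ : _ <= `|s - t| * (`|y - x| + 1)) _.
    by rewrite ler_wpM2l// lerDl.
  by rewrite -ltr_pdivlMr.
(* Parameters at which the estimate from [p 0] holds. The local estimate at the supremum [s] shows
   that [s] belongs to [T], then that [s < 1] would allow a further step. *)
pose T := [set t | 0 <= t <= 1 /\ `|f (p t) - f (p 0)| <= C * t].
have T0 : T 0 by split; [rewrite lexx ler01 | rewrite subrr normr0 mulr0].
have supT : has_sup T by split; [exists 0 | exists 1 => t [/andP[]]].
pose s := sup T.
have s0 : 0 <= s by exact: sup_upper_bound.
have s1 : s <= 1 by apply: ge_sup; [exists 0 | move=> t [/andP[]]].
have s01 : 0 <= s <= 1 by rewrite s0 s1.
have [e e0 eP] := local s s01.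
have Ts : T s.
  have [t [t01 tC] st] := sup_adherent e0 supT.
  have ts : t <= s by exact: sup_upper_bound.
  split => //; rewrite -(subrK (f (p t)) (f (p s))) -addrA.
  apply: le_trans (ler_normD _ _) _.
  have := eP t; rewrite distrC ger0_norm ?subr_ge0// distrC => /(_ _).
  by move: tC; rewrite -/s in st; lra.
have [s_lt1|] := ltP s 1; last first.
  move=> s_ge1; have s1E : s = 1 by apply/eqP; rewrite eq_le s1.
  case: Ts => _; rewrite s1E /p scale1r scale0r addr0 mulr1.
  by rewrite (addrC x) subrK.
(* [e / 2] keeps [s + a] strictly within the local radius, [1 - s] keeps it in the unit interval. *)
pose a := Num.min (e / 2) (1 - s).
have a0 : 0 < a by rewrite lt_min; apply/andP; split; lra.
have ae : a <= e / 2 by rewrite ge_min lexx.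
have as1 : a <= 1 - s by rewrite ge_min lexx orbT.
suff : T (s + a) by move=> /(sup_upper_bound supT); rewrite -/s; lra.
split; first by apply/andP; split; lra.
rewrite -(subrK (f (p s)) (f (p (s + a)))) -addrA.
apply: le_trans (ler_normD _ _) _.
have := eP (s + a); rewrite addrAC subrr add0r gtr0_norm// => /(_ _).
by case: Ts => _; lra.
Qed.

End BoundedPartials.

(** * Second differences of kernels, and bounds read off from the two norms *)

Section KernelBounds.
Context {R : realType} {d : nat}.
Notation E := 'rV[R]_d.
Implicit Types (X : set E) (k : E -> E -> R) (x y : E).

(** The increment estimate is used twice: in the second variable for [k y - k x], and in the first
    variable for its partial derivatives, which are increments of [pdy j k]. *)
Lemma second_difference_le X k x y (M : R) :
  open X -> convex_set (X : set (convex_lmodType E)) -> 0 <= M ->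
  (forall u v j, X u -> X v -> derivable (k u) v (delta_mx 0 j)) ->
  (forall u v i j, X u -> X v -> derivable (pdy j k ^~ v) u (delta_mx 0 i)) ->
  (forall u v i j, X u -> X v -> `|pdx i (pdy j k) u v| <= M) ->
  X x -> X y -> `|k y y - k x y - (k y x - k x x)| <= M * l1norm (y - x) ^+ 2.
Proof.
move=> oX cX M0 dk dpk kM Xx Xy.
rewrite expr2 mulrA.
apply: (@increment_le _ _ X (k y - k x)) => //.
- by rewrite mulr_ge0// l1norm_ge0.
- by move=> z i Xz; apply: derivableB; exact: dk.
- move=> z j Xz; rewrite /pd deriveB; [|exact: dk|exact: dk].
  by apply: (@increment_le _ _ X (pdy j k ^~ z)) => // u i Xu; [exact: dpk|exact: kM].
Qed.

Lemma pdy_sqr X k j u v : kC1 X k -> X u -> X v ->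
  pdy j (fun a b => k a b ^+ 2) u v = 2 * (k u v * pdy j k u v).
Proof.
move=> [_ /(_ j)[_ dk _ _]] Xu Xv; rewrite /pdy /pd.
rewrite (_ : (fun b => k u b ^+ 2) = k u * k u); last by apply/funext.
by rewrite deriveM; [rewrite /GRing.scale /=; ring|exact: dk|exact: dk].
Qed.

Lemma sqr_second_difference_le X k x y (M : R) :
  open X -> convex_set (X : set (convex_lmodType E)) -> 0 <= M -> kC2 X k ->
  (forall u v i j, X u -> X v ->
     `|pdx i (pdy j (fun a b => k a b ^+ 2)) u v| <= M) ->
  X x -> X y ->
  `|k y y ^+ 2 - k x y ^+ 2 - (k y x ^+ 2 - k x x ^+ 2)| <= M * l1norm (y - x) ^+ 2.
Proof.
move=> oX cX M0 [k1 k2] kM Xx Xy.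
apply: (@second_difference_le X (fun a b => k a b ^+ 2)) => //.
- move=> u v j Xu Xv; rewrite (_ : (fun b => k u b ^+ 2) = k u * k u) //.
  by apply: derivableM; case: k1 => _ /(_ j)[_ dk _ _]; exact: dk.
- move=> u v i j Xu Xv.
  (* Derivability at [u] is local, and points [a] near [u] are still in [X], where the product rule
     applies. *)
  apply: (@near_eq_derivable _ _ _ (fun a => 2 * (k a v * pdy j k a v))).
    near=> a; rewrite (pdy_sqr (X := X))//.
    by near: a; exact: open_nbhs_nbhs.
  have dk : derivable (k ^~ v) u (delta_mx 0 i).
    by case: k1 => _ /(_ i)[+ _ _ _]; exact.
  have dpk : derivable (pdy j k ^~ v) u (delta_mx 0 i).
    by case: (k2 j) => _ [_ /(_ i)[+ _ _ _]]; exact.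
  rewrite (_ : (fun a => _) = 2 *: ((k ^~ v) * (pdy j k ^~ v))).
    by apply: derivableZ; exact: derivableM.
  by apply/funext.
Unshelve. all: by end_near. Qed.

(** Cauchy-Schwarz against the all-ones vector, by summing ab <= (a^2 + b^2)/2 over all pairs of
    coordinates. *)
Lemma l1norm_sqr_le (v : E) : l1norm v ^+ 2 <= d%:R * enorm v ^+ 2.
Proof.
rewrite /enorm sqr_sqrtr; last by apply: sumr_ge0 => i _; exact: sqr_ge0.
rewrite expr2 {1}/l1norm mulr_suml.
under eq_bigr do rewrite /l1norm mulr_sumr.
apply: le_trans (_ : _ <= \sum_(i < d) \sum_(j < d)
    (2^-1 * v 0 i ^+ 2 + 2^-1 * v 0 j ^+ 2)) _.
  apply: ler_sum => i _; apply: ler_sum => j _.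
  have := sqr_ge0 (`|v 0 i| - `|v 0 j|); rewrite sqrrB !real_normK ?num_real//.
  by rewrite -mulr_natl; lra.
set S := \sum_i v 0 i ^+ 2.
have rowE i : \sum_(j < d) (2^-1 * v 0 i ^+ 2 + 2^-1 * v 0 j ^+ 2) =
    d%:R * (2^-1 * v 0 i ^+ 2) + 2^-1 * S.
  by rewrite big_split /= sumr_const card_ord -mulr_sumr mulr_natl.
under eq_bigr do rewrite rowE.
rewrite big_split /= -!mulr_sumr sumr_const card_ord -/S -[S *+ d]mulr_natl.
by lra.
Qed.

Lemma Dk_ge0 X k : 0 <= Dk X k.
Proof. exact: sqrtr_ge0. Qed.

Lemma Dk_bounds X k x y (i j : 'I_d) : (Dk_sq X k < +oo)%E -> X x -> X y ->
  [/\ `|pdx i (pdy j (fun u v => k u v ^+ 2)) x y| <= Dk X k ^+ 2,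
      `|pdx i (pdy j k) x y| <= Dk X k ^+ 2 &
      `|k x y| <= Dk X k ^+ 2].
Proof.
move=> kfin Xx Xy.
have max5 (p q r s o : R) (m := Num.max p (Num.max q (Num.max r (Num.max s o)))) :
    [/\ p <= m, q <= m & o <= m].
  by rewrite /m !le_max !lexx !orbT.
have := max5 `|pdx i (pdy j (fun u v => k u v ^+ 2)) x y| `|pdx i (pdy j k) x y|
  `|pdx i k x y| `|pdy j k x y| `|k x y|.
set t := Num.max `|pdx i (pdy j (fun u v => k u v ^+ 2)) x y|
  (Num.max `|pdx i (pdy j k) x y|
  (Num.max `|pdx i k x y| (Num.max `|pdy j k x y| `|k x y|))) => - {}max5.
have tD : (t%:E <= Dk_sq X k)%E.
  by apply: ereal_sup_ubound; exists x, y, i, j.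
(* The member [t] keeps the supremum away from -oo; being nonnegative, it also makes [Dk X k ^+ 2]
   equal to [fine (Dk_sq X k)]. *)
have Dfin : Dk_sq X k \is a fin_num.
  by rewrite fin_numE -ltNye -ltey kfin (lt_le_trans _ tD) ?ltNyr.
have tfine : t <= fine (Dk_sq X k) by rewrite -lee_fin fineK.
have t0 : 0 <= t by rewrite le_max normr_ge0.
rewrite /Dk sqr_sqrtr; last exact: le_trans tfine.
have [m1 m2 m3] := max5.
split; [exact: le_trans m1 tfine | exact: le_trans m2 tfine | exact: le_trans m3 tfine].
Qed.

(** [x0] and an index make both suprema run over nonempty sets, so both are nonnegative, and
    finiteness of their sum gives finiteness of each. *)
Lemma C1norm_bounds X (f : E -> R) x0 : (0 < d)%N -> X x0 -> C1space X f ->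
  exists a0 a1, [/\ 0 <= a0, 0 <= a1, fine (C1norm X f) = a0 + a1,
    forall x, X x -> `|f x| <= a0 & forall x i, X x -> `|pd i f x| <= a1].
Proof.
move=> d0 Xx0 [_]; rewrite /C1norm.
set S0 := ereal_sup _; set S1 := ereal_sup _ => Sfin.
have S0P x : X x -> (`|f x|%:E <= S0)%E.
  by move=> Xx; apply: ereal_sup_ubound; exists x.
have S1P x i : X x -> (`|pd i f x|%:E <= S1)%E.
  by move=> Xx; apply: ereal_sup_ubound; exists x, i.
have S00 : (0 <= S0)%E by apply: le_trans (S0P x0 Xx0); rewrite lee_fin.
have S10 : (0 <= S1)%E.
  by apply: le_trans (S1P x0 (Ordinal d0) Xx0); rewrite lee_fin.
have S0fin : S0 \is a fin_num.
  by rewrite ge0_fin_numE//; apply: le_lt_trans Sfin; rewrite leeDl.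
have S1fin : S1 \is a fin_num.
  by rewrite ge0_fin_numE//; apply: le_lt_trans Sfin; rewrite leeDr.
exists (fine S0), (fine S1); split.
- by rewrite fine_ge0.
- by rewrite fine_ge0.
- by rewrite fineD.
- by move=> x /S0P; rewrite -[in X in X -> _](fineK S0fin) lee_fin.
- by move=> x i /S1P => /(_ i); rewrite -[in X in X -> _](fineK S1fin) lee_fin.
Qed.

End KernelBounds.

(** * Integrals of bounded functions and couplings *)

(* Unlike [ge0_le_integral], no measurability: the integral of a nonnegative
   function is a supremum over the simple functions below it. *)
Lemma ge0_le_integralT {dT} {T : measurableType dT} {R : realType}
    (mu : {measure set T -> \bar R}) (f g : T -> \bar R) :
  (forall x, (0 <= f x)%E) -> (forall x, (f x <= g x)%E) ->
  (\int[mu]_x f x <= \int[mu]_x g x)%E.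
Proof.
move=> f0 fg; have g0 x : (0 <= g x)%E by exact: le_trans (fg x).
rewrite !ge0_integralTE//; apply: le_ereal_sup => _ [h /= hf <-].
by exists h => // x; apply: le_trans (fg x); exact: hf.
Qed.

Section BoundedMeasurable.
Context {dT} {T : measurableType dT} {R : realType}.
Implicit Types (D : set T) (f g : T -> R).

(** A class closed under sums and products, integrable on measurable sets for every probability
    measure. *)
Definition bounded_measurable D f :=
  measurable_fun D f /\ exists B, forall x, D x -> `|f x| <= B.

Lemma bounded_measurable_cst D (a : R) : bounded_measurable D (fun=> a).
Proof. by split; [exact: measurable_cst | exists `|a|]. Qed.

Lemma bounded_measurableD D f g : bounded_measurable D f ->
  bounded_measurable D g -> bounded_measurable D (fun x => f x + g x).
Proof.
move=> [mf [a fa]] [mg [b gb]]; split; first exact: measurable_funD.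
exists (a + b) => x Dx; apply: le_trans (ler_normD _ _) _.
by rewrite lerD ?fa ?gb.
Qed.

Lemma bounded_measurableM D f g : bounded_measurable D f ->
  bounded_measurable D g -> bounded_measurable D (fun x => f x * g x).
Proof.
move=> [mf [a fa]] [mg [b gb]]; split; first exact: measurable_funM.
by exists (a * b) => x Dx; rewrite normrM ler_pM ?fa ?gb.
Qed.

Lemma bounded_measurableB D f g : bounded_measurable D f ->
  bounded_measurable D g -> bounded_measurable D (fun x => f x - g x).
Proof.
move=> [mf [a fa]] [mg [b gb]]; split; first exact: measurable_funB.
exists (a + b) => x Dx; apply: le_trans (ler_normB _ _) _.
by rewrite lerD ?fa ?gb.
Qed.

Lemma bounded_measurable_integrable (mu : probability T R) D f :
  measurable D -> bounded_measurable D f -> mu.-integrable D (EFin \o f).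
Proof.
move=> mD [mf [B fB]]; apply: measurable_bounded_integrable => //.
  by rewrite (le_lt_trans (probability_le1 _ mD))// ltry.
exists B; split; first by rewrite num_real.
by move=> c Bc x Dx; exact: le_trans (fB x Dx) (ltW Bc).
Qed.

Lemma EFin_Rintegral (mu : probability T R) D f :
  measurable D -> bounded_measurable D f ->
  (\int[mu]_(x in D) (f x)%:E)%E = (\int[mu]_(x in D) f x)%:E.
Proof.
move=> mD bf; rewrite /Rintegral fineK//.
by apply: integrable_fin_num => //; exact: bounded_measurable_integrable.
Qed.

Lemma Rintegral_norm_le (mu : probability T R) D f (B : R) :
  measurable D -> mu D = 1%E -> measurable_fun D f ->
  (forall x, D x -> `|f x| <= B) -> `|\int[mu]_(x in D) f x| <= B.
Proof.
move=> mD muD mf fB.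
have bf : bounded_measurable D f by split => //; exists B.
have bnf : bounded_measurable D (Num.norm \o f).
  by split; [exact: measurableT_comp | exists B => x Dx; rewrite normr_id fB].
have := @le_normr_Rintegral _ _ _ mu D f mD (bounded_measurable_integrable mu mD bf).
move=> /le_trans; apply.
rewrite -[leRHS]mulr1 -[X in _ * X]/(fine 1%E) -muD -Rintegral_cst//.
apply: le_Rintegral => //; apply: bounded_measurable_integrable => //.
exact: bounded_measurable_cst.
Qed.

End BoundedMeasurable.

Section Coupling.
Context {dT} {T : measurableType dT} {dO} {O : measurableType dO} {R : realType}.
Variables (P : probability O R) (U V : {mfun O >-> T}).

Lemma Rintegral_coupling (mu : probability T R) (W : {mfun O >-> T})
    (D : set T) (f : T -> R) :
  measurable D -> bounded_measurable D f ->
  (forall B, measurable B -> distribution P W B = mu B) ->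
  \int[mu]_(x in D) f x = \int[P]_w (f \_ D) (W w).
Proof.
move=> mD [mf [B fB]] WP; rewrite Rintegral_mkcond /Rintegral.
congr fine; transitivity (\int[distribution P W]_x ((f \_ D) x)%:E)%E.
  by apply: eq_measure_integral => A mA _; exact/esym/WP.
have mfD : measurable_fun setT (f \_ D) by apply/(measurable_restrictT _ mD).
rewrite integral_distribution//.
  exact/measurable_EFinP.
apply: (bounded_measurable_integrable P measurableT).
split; first exact: measurableT_comp.
(* The restriction is 0 off [D], and [B] may be negative when [D] is empty, hence the absolute
   value. *)
exists `|B| => w _ /=; rewrite patchE; case: ifPn => [|_]; last by rewrite normr0.
by rewrite inE => /fB /le_trans; apply; exact: ler_norm.
Qed.

(** The difference of integrals is the mean of f(U) - f(V), and both points lie in [D] almost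
    surely, where the Lipschitz bound applies. *)
Lemma coupling_bound (mu nu : probability T R) (D : set T) (f : T -> R)
    (c : T -> T -> R) (L : R) :
  measurable D -> mu D = 1%E -> nu D = 1%E -> bounded_measurable D f ->
  (forall B, measurable B -> distribution P U B = mu B) ->
  (forall B, measurable B -> distribution P V B = nu B) ->
  0 < L -> (forall x y, 0 <= c x y) ->
  (forall x y, D x -> D y -> `|f x - f y| <= L * c x y) ->
  ((\int[mu]_(x in D) f x - \int[nu]_(x in D) f x)%:E <=
   L%:E * \int[P]_w (c (U w) (V w))%:E)%E.
Proof.
move=> mD muD nuD bf UP VP L0 c0 fL.
rewrite (Rintegral_coupling mD bf UP) (Rintegral_coupling mD bf VP).
have [mf [B fB]] := bf.
have mfD : measurable_fun setT (f \_ D) by apply/(measurable_restrictT _ mD).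
have bfD (W : {mfun O >-> T}) : bounded_measurable setT (fun w => (f \_ D) (W w)).
  split; first exact: measurableT_comp.
  exists `|B| => w _ /=; rewrite patchE; case: ifPn => [|_]; last by rewrite normr0.
  by rewrite inE => /fB /le_trans; apply; exact: ler_norm.
pose S := (U @^-1` D) `&` (V @^-1` D).
have mpre (W : {mfun O >-> T}) : measurable (W @^-1` D).
  exact: measurable_funPTI.
have mS : measurable S by apply: measurableI; exact: mpre.
have PSc : P (~` S) = 0%E.
  rewrite setCI; apply/eqP; rewrite eq_le measure_ge0 andbT.
  have mC (W : {mfun O >-> T}) : measurable (~` (W @^-1` D)) by exact: measurableC.
  have PC (W : {mfun O >-> T}) (rho : probability T R) : rho D = 1%E ->
      (forall B, measurable B -> distribution P W B = rho B) ->
      P (~` (W @^-1` D)) = 0%E.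
    move=> rhoD WP; rewrite probability_setC//.
    have -> : P (W @^-1` D) = 1%E by rewrite -rhoD -WP.
    by rewrite subee.
  apply: (@le_trans _ _ (P (~` (U @^-1` D)) + P (~` (V @^-1` D)))%E).
    exact: measureU2.
  by rewrite (PC U mu)// (PC V nu)// adde0.
pose g w := (f \_ D) (U w) - (f \_ D) (V w).
have bg : bounded_measurable setT g by exact: bounded_measurableB (bfD U) (bfD V).
have bng : bounded_measurable setT (Num.norm \o g).
  case: bg => mg [C gC]; split; first exact: measurableT_comp.
  by exists C => w Dw; rewrite normr_id gC.
have bI h : bounded_measurable setT h -> P.-integrable setT (EFin \o h).
  exact: bounded_measurable_integrable.
have EFin_le (a b : R) : a <= b -> (a%:E <= b%:E)%E by rewrite lee_fin.
rewrite -RintegralB//; [|exact: bI|exact: bI].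
apply: (@le_trans _ _ (\int[P]_w `|g w|)%:E).
  apply: EFin_le; apply: le_Rintegral => //; [exact: bI|exact: bI|].
  by move=> w _; exact: ler_norm.
rewrite -EFin_Rintegral// (@negligible_integral _ _ _ _ _ (~` S))//; last 2 first.
- exact: measurableC.
- exact: bI.
(* [c] carries no measurability, so [L] is moved to the side of [g], whose integral can be scaled,
   and the comparison is left to [ge0_le_integralT]. *)
rewrite setTD setCK -lee_pdivrMl// integral_mkcond -ge0_integralZl//.
- apply: ge0_le_integralT => w.
    apply: mule_ge0; first by rewrite lee_fin invr_ge0 ltW.
    by apply: erestrict_ge0 => ? _; rewrite lee_fin.
  rewrite patchE; case: ifPn => [|_]; last by rewrite mule0 lee_fin.
  rewrite inE => -[Uw Vw]; rewrite -EFinM lee_fin ler_pdivrMl// /g !patchE.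
  by rewrite !mem_set// fL.
- apply/(measurable_restrictT _ mS)/measurable_EFinP.
  by apply: measurable_funTS; case: bng.
- by move=> w _; apply: erestrict_ge0 => // ? _; rewrite lee_fin.
- by rewrite lee_fin invr_ge0 ltW.
Qed.
End Coupling.

(** * Borel measurability, comparison of norms and continuity on R^d *)

Lemma open_continuous_borel_measurable {R : realType} {d : nat}
    (U : set ('rV[R]_d * 'rV[R]_d)) (f : 'rV[R]_d * 'rV[R]_d -> R) :
  open U -> (forall x, U x -> {for x, continuous f}) ->
  measurable_fun (U : set (@borel2 R d)) f.
Proof.
(* Open intervals generate the Borel sets of the line, and the part of their preimage inside the
   open set [U] is open. *)
move=> oU cf; apply: (measurability _ (RGenOpens.measurableE R)).
move=> _ [_ [a [b ->] <-]]; apply: sub_sigma_algebra; rewrite openE => x [Ux fx].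
apply: filterI; first exact: open_nbhs_nbhs.
by apply: (cf x Ux); apply: open_nbhs_nbhs; split => //; exact: interval_open.
Qed.

Section Euclidean.
Context {R : realType} {d : nat}.
Notation E := 'rV[R]_d.

Lemma enorm_ge0 (v : E) : 0 <= enorm v. Proof. exact: sqrtr_ge0. Qed.

Lemma l1norm_le_enorm (v : E) : l1norm v <= Num.sqrt d%:R * enorm v.
Proof.
rewrite -(ler_pXn2r (n := 2)) ?nnegrE ?l1norm_ge0//; last first.
  by rewrite mulr_ge0 ?sqrtr_ge0.
by rewrite exprMn sqr_sqrtr ?ler0n// l1norm_sqr_le.
Qed.

Lemma l1norm_le_norm (v : E) : l1norm v <= d%:R * `|v|.
Proof.
rewrite /l1norm -[in d%:R](card_ord d) mulr_natl -sumr_const ler_sum// => i _.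
rewrite [leRHS]mx_normrE; exact: (le_bigmax _ (fun ij => `|v ij.1 ij.2|) (0, i)).
Qed.

Lemma enorm2_ge0 (z : E * E) : 0 <= enorm2 z. Proof. exact: sqrtr_ge0. Qed.

Lemma enorm_le_enorm2 (z : E * E) : enorm z.1 <= enorm2 z /\ enorm z.2 <= enorm2 z.
Proof.
by split; rewrite -[leLHS]ger0_norm ?enorm_ge0// -sqrtr_sqr ler_wsqrtr// ?lerDl ?lerDr ?sqr_ge0.
Qed.

Lemma lipschitz_l1_continuous (X : set E) (f : E -> R) (C : R) :
  open X -> 0 <= C ->
  (forall x y, X x -> X y -> `|f x - f y| <= C * l1norm (x - y)) ->
  forall x, X x -> {for x, continuous f}.
Proof.
move=> oX C0 fC x Xx; rewrite /prop_for /continuous_at.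
apply/(@cvgrPdist_lt _ _ _ (nbhs x) (nbhs_filter x)) => e e0.
have C1 : 0 < C * d%:R + 1 by rewrite ltr_wpDl// mulr_ge0.
near=> y; apply: le_lt_trans (fC _ _ Xx _) _; first by near: y; exact: open_nbhs_nbhs.
apply: (@le_lt_trans _ _ ((C * d%:R + 1) * `|x - y|)).
  rewrite mulrDl mul1r -mulrA; apply: ler_wpDr => //.
  by rewrite ler_wpM2l// l1norm_le_norm.
rewrite mulrC -ltr_pdivlMr//; near: y.
have e'0 : 0 < e / (C * d%:R + 1) by rewrite divr_gt0.
by have := nbhsx_ballx x _ e'0; rewrite -ball_normE.
Unshelve. all: by end_near. Qed.

End Euclidean.

(** * Reproducing kernel Hilbert spaces *)

Section RKHS.
Context {R : realType} {T : Type} {X : set T} {k : T -> T -> R} (H : rkhs X k).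
Notation ev := (@rkhs_eval _ _ _ _ H).
Notation dot := (@rkhs_dot _ _ _ _ H).
Implicit Types (f g : H) (x y : T).

Lemma rkhs_evalD f g x : X x -> ev (f + g) x = ev f x + ev g x.
Proof. by move=> Xx; rewrite -{1}(scale1r f) rkhs_linear// mul1r. Qed.

Lemma rkhs_eval0 x : X x -> ev 0 x = 0.
Proof. by move=> Xx; have := rkhs_evalD 0 0 Xx; rewrite addr0; lra. Qed.

Lemma rkhs_evalZ a f x : X x -> ev (a *: f) x = a * ev f x.
Proof. by move=> Xx; rewrite -{1}(addr0 (a *: f)) rkhs_linear// rkhs_eval0// addr0. Qed.

Lemma rkhs_evalB f g x : X x -> ev (f - g) x = ev f x - ev g x.
Proof. by move=> Xx; rewrite -scaleN1r rkhs_evalD// rkhs_evalZ//; ring. Qed.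

Lemma rkhs_eval_le f x : X x -> ev f x ^+ 2 <= `|f| ^+ 2 * k x x.
Proof.
move=> Xx; have [kx [kxE evE]] := rkhs_reproducing H Xx.
have -> : k x x = `|kx| ^+ 2 by rewrite rkhs_normE -evE kxE.
rewrite evE -exprMn -(real_normK (num_real (dot f kx))).
rewrite ler_pXn2r ?nnegrE ?mulr_ge0 //.
by apply: cauchy_schwarz; exact: rkhs_normE.
Qed.

(** Cauchy-Schwarz against [kx - ky], whose squared norm is the second difference of [k]. *)
Lemma rkhs_eval_diff_le f x y : X x -> X y ->
  (ev f x - ev f y) ^+ 2 <= `|f| ^+ 2 * (k x x - k y x - (k x y - k y y)).
Proof.
move=> Xx Xy.
have [kx [kxE evx]] := rkhs_reproducing H Xx.
have [ky [kyE evy]] := rkhs_reproducing H Xy.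
have -> : k x x - k y x - (k x y - k y y) = `|kx - ky| ^+ 2.
  rewrite (sqr_normB (@rkhs_normE _ _ _ _ H)) !rkhs_normE -!evx -!evy !kxE// !kyE//.
  by rewrite -(kxE y Xy) evy dotC -evx kyE//; ring.
rewrite evx evy -linearBr -exprMn -(real_normK (num_real (dot f _))).
rewrite ler_pXn2r ?nnegrE ?mulr_ge0 //.
by apply: cauchy_schwarz; exact: rkhs_normE.
Qed.

Lemma rkhs_mul_diff_le f g x y : X x -> X y ->
  (ev f x * ev g x - ev f y * ev g y) ^+ 2 <=
  (`|f| * `|g|) ^+ 2 * (k x x ^+ 2 - k y x ^+ 2 - (k x y ^+ 2 - k y y ^+ 2)).
Proof.
move=> Xx Xy.
have [kx [kxE evx]] := rkhs_reproducing H Xx.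
have [ky [kyE evy]] := rkhs_reproducing H Xy.
rewrite !evx !evy; apply: le_trans (dot_mul_diff (@rkhs_normE _ _ _ _ H) f g kx ky) _.
rewrite le_eqVlt; apply/orP; left; apply/eqP; congr (_ * _).
have -> : `|kx| ^+ 4 = k x x ^+ 2 by rewrite (exprM _ 2 2) rkhs_normE -evx kxE.
have -> : `|ky| ^+ 4 = k y y ^+ 2 by rewrite (exprM _ 2 2) rkhs_normE -evy kyE.
have -> : k x y = dot kx ky by rewrite -evy kxE.
have -> : k y x = dot kx ky by rewrite dotC -evx kyE.
by ring.
Qed.

End RKHS.

(** * The regularized risk and its minimizer *)

Section Minimizer.
Context {R : realType} {d : nat}.
Notation E := 'rV[R]_d.
Context {X : set E} {k : E -> E -> R} (H : rkhs X k) (A : E -> R).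
Variables (lambda a0 D : R).
Notation ev := (@rkhs_eval _ _ _ _ H).
Notation dot := (@rkhs_dot _ _ _ _ H).
Notation XX := (X `*` X : set (@borel2 R d)).
Hypotheses (oX : open X) (lambda0 : 0 < lambda) (D0 : 0 <= D) (a0_ge0 : 0 <= a0)
  (A_le : forall x, X x -> `|A x| <= a0)
  (A_cont : forall x, X x -> {for x, continuous A})
  (ev_le : forall f x, X x -> `|ev f x| <= D * `|f|)
  (ev_cont : forall f x, X x -> {for x, continuous (ev f)}).
Implicit Types (f g : H) (mu nu : probability (@borel2 R d) R).

Lemma open_square : open (X `*` X).
Proof.
rewrite openE => -[x y] [/= Xx Xy]; exists (X, X); last by [].
by split; exact: open_nbhs_nbhs.
Qed.

Lemma measurable_square : measurable XX.
Proof. by apply: sub_sigma_algebra; exact: open_square. Qed.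
Hint Resolve measurable_square : core.

Lemma bounded_measurable_label : bounded_measurable XX (fun z => A z.2).
Proof.
split; last by exists a0 => z [_ Xz]; exact: A_le.
apply: open_continuous_borel_measurable; first exact: open_square.
move=> z [_ Xz]; apply: (@continuous_comp _ _ _ snd A); last exact: A_cont.
exact: cvg_snd.
Qed.

Lemma bounded_measurable_eval f : bounded_measurable XX (fun z => ev f z.1).
Proof.
split; last by exists (D * `|f|) => z [Xz _]; exact: ev_le.
apply: open_continuous_borel_measurable; first exact: open_square.
move=> z [Xz _]; apply: (@continuous_comp _ _ _ fst (ev f)); last exact: ev_cont.
exact: cvg_fst.
Qed.

Notation I nu := (Rintegral nu XX).

Definition real_risk nu f :=
  I nu (fun z => (A z.2 - ev f z.1) * (A z.2 - ev f z.1)) + lambda * `|f| ^+ 2.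

(** Half the directional derivative of the risk at [f] along [g]. *)
Definition risk_slope nu f g :=
  I nu (fun z => (ev f z.1 - A z.2) * ev g z.1) + lambda * dot f g.

Definition risk_curvature nu g :=
  I nu (fun z => ev g z.1 * ev g z.1) + lambda * `|g| ^+ 2.

Let bmA := bounded_measurable_label.
Let bme := bounded_measurable_eval.
Let bmres f : bounded_measurable XX (fun z => ev f z.1 - A z.2).
Proof. exact: bounded_measurableB. Qed.
Let bmi nu F : bounded_measurable XX F -> nu.-integrable XX (EFin \o F).
Proof. exact: bounded_measurable_integrable. Qed.

Lemma riskE nu f : risk A lambda nu f = (real_risk nu f)%:E.
Proof.
rewrite /risk /real_risk EFinD; congr (_ + _)%E.
rewrite -EFin_Rintegral//; last by apply: bounded_measurableM; apply: bounded_measurableB.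
by apply: eq_integral => z _; rewrite real_normK ?num_real// expr2.
Qed.

Lemma real_riskD nu f g :
  real_risk nu (f + g) = real_risk nu f + 2 * risk_slope nu f g + risk_curvature nu g.
Proof.
rewrite /real_risk /risk_slope /risk_curvature (sqr_normD (@rkhs_normE _ _ _ _ H)).
suff -> : I nu (fun z => (A z.2 - ev (f + g) z.1) * (A z.2 - ev (f + g) z.1)) =
    I nu (fun z => (A z.2 - ev f z.1) * (A z.2 - ev f z.1)) +
    2 * I nu (fun z => (ev f z.1 - A z.2) * ev g z.1) +
    I nu (fun z => ev g z.1 * ev g z.1) by ring.
have bmAf : bounded_measurable XX (fun z => A z.2 - ev f z.1).
  exact: bounded_measurableB.
have bm2 : bounded_measurable XX (fun z => 2 * ((ev f z.1 - A z.2) * ev g z.1)).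
  apply: bounded_measurableM; first exact: bounded_measurable_cst.
  exact: bounded_measurableM.
rewrite -RintegralZl//; last exact/bmi/bounded_measurableM.
rewrite -RintegralD//; [|exact/bmi/bounded_measurableM|exact/bmi].
rewrite -RintegralD//; [|apply/bmi/bounded_measurableD => //|]; last 2 first.
- exact: bounded_measurableM.
- exact/bmi/bounded_measurableM.
apply: eq_Rintegral => z; rewrite inE => -[Xz _].
by rewrite rkhs_evalD//; ring.
Qed.

Lemma risk_slopeZ nu a f g : risk_slope nu f (a *: g) = a * risk_slope nu f g.
Proof.
rewrite /risk_slope dotZr mulrDr mulrCA; congr (_ + _).
rewrite -RintegralZl//; last exact/bmi/bounded_measurableM.
apply: eq_Rintegral => z; rewrite inE => -[Xz _].
by rewrite rkhs_evalZ//; ring.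
Qed.

Lemma risk_curvatureZ nu a g :
  risk_curvature nu (a *: g) = a ^+ 2 * risk_curvature nu g.
Proof.
rewrite /risk_curvature normrZ exprMn real_normK ?num_real// mulrDr mulrCA.
congr (_ + _); rewrite -RintegralZl//; last exact/bmi/bounded_measurableM.
apply: eq_Rintegral => z; rewrite inE => -[Xz _].
by rewrite rkhs_evalZ//; ring.
Qed.

Lemma le_risk_curvature nu g : lambda * `|g| ^+ 2 <= risk_curvature nu g.
Proof. by rewrite lerDr; apply: Rintegral_ge0 => z _; exact: sqr_ge0. Qed.

(** The expansion [real_riskD] gives existence through [quadratic_minimizer]; the risk along a line
    through the minimizer then has no linear term. *)
Lemma minimizerP nu g : nu XX = 1%E ->
  risk_slope nu (minimizer H A lambda nu) g = 0.
Proof.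
move=> nuXX.
have [m mP] : exists m, forall f, real_risk nu m <= real_risk nu f.
  apply: (@quadratic_minimizer _ _ _ (risk_curvature nu) (risk_slope nu) lambda) => //.
  - move=> f; apply: addr_ge0; last by rewrite mulr_ge0 ?exprn_ge0 ?(ltW lambda0).
    by apply: Rintegral_ge0 => z _; exact: sqr_ge0.
  - exact: real_riskD.
  - exact: risk_slopeZ.
  - exact: risk_curvatureZ.
  - exact: le_risk_curvature.
  (* The residual is at most D|f| + a0 and the direction evaluates to at most D times its norm; the
     last summand is Cauchy-Schwarz for the penalty. *)
  - move=> f; exists ((D * `|f| + a0) * D + lambda * `|f|).
      by rewrite addr_ge0 ?mulr_ge0 ?addr_ge0 ?mulr_ge0// ltW.
    move=> h; apply: le_trans (ler_normD _ _) _; rewrite mulrDl; apply: lerD.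
      have [mes _] := bounded_measurableM (bmres f) (bme h).
      apply: Rintegral_norm_le => // z [Xz Xz'].
      rewrite normrM -mulrA ler_pM ?ev_le//.
      apply: le_trans (ler_normB _ _) _; rewrite lerD ?ev_le ?A_le//.
    rewrite normrM (gtr0_norm lambda0) -mulrA ler_wpM2l ?(ltW lambda0)//.
    by apply: cauchy_schwarz; exact: rkhs_normE.
have minP f : real_risk nu (minimizer H A lambda nu) <= real_risk nu f.
  (* [xget] falls back on its default 0 only if no minimizer exists, which [m] rules out. *)
  rewrite /minimizer; case: xgetP => [m' _ m'P|nom].
    by have := m'P f; rewrite !riskE lee_fin.
  by exfalso; apply: (nom m) => h; rewrite !riskE lee_fin.
apply: (@linear_term_eq0 _ _ (risk_curvature nu g)).
  by apply: le_trans (le_risk_curvature nu g); rewrite mulr_ge0 ?exprn_ge0 ?(ltW lambda0).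
move=> t; have := minP (minimizer H A lambda nu + t *: g).
by rewrite real_riskD risk_slopeZ risk_curvatureZ; lra.
Qed.

(** The first-order condition is tested with [m] itself; the integral of m(x)^2 is dropped by sign
    and one factor |m| cancels. *)
Lemma minimizer_norm_le nu : nu XX = 1%E ->
  lambda * `|minimizer H A lambda nu| <= a0 * D.
Proof.
move=> nuXX; have := minimizerP (minimizer H A lambda nu) nuXX.
set m := minimizer _ _ _ _.
have [->|m0] := eqVneq m 0; first by rewrite normr0 mulr0 mulr_ge0.
have mp : 0 < `|m| by rewrite normr_gt0.
rewrite /risk_slope -rkhs_normE => slope0.
rewrite -(ler_pM2r mp) -mulrA -expr2.
have : `|I nu (fun z => A z.2 * ev m z.1)| <= a0 * (D * `|m|).
  have [mes _] := bounded_measurableM bmA (bme m).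
  apply: Rintegral_norm_le => // z [Xz Xz'].
  by rewrite normrM ler_pM ?ev_le ?A_le.
rewrite ler_norml mulrA => /andP[_]; apply: le_trans.
have -> : lambda * `|m| ^+ 2 = - I nu (fun z => (ev m z.1 - A z.2) * ev m z.1).
  by move: slope0; lra.
rewrite -mulN1r -RintegralZl//; last exact/bmi/bounded_measurableM.
apply: le_Rintegral => //.
- apply: bmi; apply: bounded_measurableM; first exact: bounded_measurable_cst.
  exact: bounded_measurableM.
- exact/bmi/bounded_measurableM.
- by move=> z _; have := sqr_ge0 (ev m z.1); lra.
Qed.

(** [phi] carries the residual of [n] under both measures. Putting it in place of that of [m] under
    [mu] changes the integral by that of (m - n)(x)^2, which has the favourable sign. *)
Lemma minimizer_diff_le mu nu (m := minimizer H A lambda mu)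
    (n := minimizer H A lambda nu)
    (phi := fun z : E * E => (A z.2 - ev n z.1) * ev (m - n) z.1) :
  mu XX = 1%E -> nu XX = 1%E ->
  lambda * `|m - n| ^+ 2 <= I mu phi - I nu phi.
Proof.
move=> muXX nuXX; pose g := m - n.
have := minimizerP g muXX; have := minimizerP g nuXX.
rewrite /risk_slope -/m -/n => slope_nu slope_mu.
have bphi : bounded_measurable XX phi.
  by apply: bounded_measurableM => //; exact: bounded_measurableB.
have phiN : I nu (fun z => (ev n z.1 - A z.2) * ev g z.1) = - I nu phi.
  rewrite -mulN1r -RintegralZl//; last exact: bmi.
  by apply: eq_Rintegral => z _; rewrite /phi -/g; ring.
have phiM : - I mu (fun z => (ev m z.1 - A z.2) * ev g z.1) <= I mu phi.
  rewrite -mulN1r -RintegralZl//; last exact/bmi/bounded_measurableM.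
  apply: le_Rintegral => //.
  - apply: bmi; apply: bounded_measurableM; first exact: bounded_measurable_cst.
    exact: bounded_measurableM.
  - exact: bmi.
  - move=> z [Xz _]; rewrite /phi -/g.
    by have := sqr_ge0 (ev g z.1); rewrite {1}/g rkhs_evalB//; lra.
have -> : `|g| ^+ 2 = dot m g - dot n g by rewrite rkhs_normE linearBl.
by move: slope_nu slope_mu phiM; rewrite phiN; lra.
Qed.

End Minimizer.

(** * Lipschitz bounds for elements of the RKHS and for the residual *)

Lemma norm_le_of_sqr {R : realType} (a c : R) : 0 <= c -> a ^+ 2 <= c ^+ 2 -> `|a| <= c.
Proof.
by move=> c0 ac; rewrite -(ler_pXn2r (n := 2)) ?nnegrE// real_normK ?num_real.
Qed.

Section LipschitzRKHS.
Context {R : realType} {d : nat}.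
Notation E := 'rV[R]_d.
Context {X : set E} {k : E -> E -> R} (H : rkhs X k).
Hypotheses (d0 : (0 < d)%N) (oX : open X)
  (cX : convex_set (X : set (convex_lmodType E))) (k2 : kC2 X k)
  (kfin : (Dk_sq X k < +oo)%E).
Notation ev := (@rkhs_eval _ _ _ _ H).
Notation D := (Dk X k).

Lemma rkhs_eval_norm_le f x : X x -> `|ev f x| <= D * `|f|.
Proof.
move=> Xx; apply: norm_le_of_sqr; first by rewrite mulr_ge0 ?Dk_ge0.
apply: le_trans (rkhs_eval_le f Xx) _; rewrite exprMn mulrC ler_wpM2r ?exprn_ge0//.
(* The supremum that bounds [k] also ranges over pairs of indices; [d0] supplies one. *)
have [_ _] := Dk_bounds (Ordinal d0) (Ordinal d0) kfin Xx Xx.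
by apply: le_trans; exact: ler_norm.
Qed.

Lemma rkhs_eval_lipschitz f x y : X x -> X y ->
  `|ev f x - ev f y| <= D * `|f| * l1norm (x - y).
Proof.
move=> Xx Xy; apply: norm_le_of_sqr.
  by rewrite !mulr_ge0 ?Dk_ge0 ?l1norm_ge0.
apply: le_trans (rkhs_eval_diff_le f Xx Xy) _.
rewrite [leRHS](_ : _ = `|f| ^+ 2 * (D ^+ 2 * l1norm (x - y) ^+ 2)); last by ring.
apply: ler_wpM2l; first exact: exprn_ge0.
apply: le_trans (ler_norm _) _.
apply: (second_difference_le oX cX) => //; first by rewrite exprn_ge0// Dk_ge0.
- by move=> u v j Xu Xv; case: k2 => [[_ /(_ j)[_ dk _ _]] _]; exact: dk.
- by move=> u v i j Xu Xv; case: k2 => _ /(_ j)[_ [_ /(_ i)[dk _ _ _]]]; exact: dk.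
- by move=> u v i j Xu Xv; case: (Dk_bounds i j kfin Xu Xv).
Qed.

Lemma rkhs_mul_lipschitz f g x y : X x -> X y ->
  `|ev f x * ev g x - ev f y * ev g y| <= D * (`|f| * `|g|) * l1norm (x - y).
Proof.
move=> Xx Xy; apply: norm_le_of_sqr.
  by rewrite !mulr_ge0 ?Dk_ge0 ?l1norm_ge0.
apply: le_trans (rkhs_mul_diff_le f g Xx Xy) _.
rewrite [leRHS](_ : _ = (`|f| * `|g|) ^+ 2 * (D ^+ 2 * l1norm (x - y) ^+ 2)); last by ring.
apply: ler_wpM2l; first exact: sqr_ge0.
apply: le_trans (ler_norm _) _.
apply: (sqr_second_difference_le oX cX) => //; first by rewrite exprn_ge0// Dk_ge0.
by move=> u v i j Xu Xv; case: (Dk_bounds i j kfin Xu Xv).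
Qed.

Lemma rkhs_eval_continuous f x : X x -> {for x, continuous (ev f)}.
Proof.
apply: (@lipschitz_l1_continuous _ _ X _ (D * `|f|)) => //.
  by rewrite mulr_ge0 ?Dk_ge0.
exact: rkhs_eval_lipschitz.
Qed.

(* The factor [ev n * ev g] is treated as an element of the RKHS of k^2;
   the product rule would give an extra factor of D. *)
Lemma residual_lipschitz (A : E -> R) (a0 a1 : R) (n g : H) (z z' : E * E) :
  0 <= a0 -> 0 <= a1 ->
  (forall x, X x -> `|A x| <= a0) ->
  (forall x y, X x -> X y -> `|A x - A y| <= a1 * l1norm (x - y)) ->
  (X `*` X) z -> (X `*` X) z' ->
  `|(A z.2 - ev n z.1) * ev g z.1 - (A z'.2 - ev n z'.1) * ev g z'.1|
    <= Num.sqrt d%:R * D * (a0 + a1 + `|n|) * `|g| * enorm2 (z - z').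
Proof.
move=> a00 a10 A_le A_lip [Xz1 Xz2] [Xz1' Xz2'].
set s := Num.sqrt d%:R; have s0 : 0 <= s by exact: sqrtr_ge0.
have D0 := Dk_ge0 X k.
set e := enorm2 (z - z'); have e0 : 0 <= e by exact: enorm2_ge0.
have [/= e1 e2] := enorm_le_enorm2 (z - z').
have l1 : l1norm (z.1 - z'.1) <= s * e.
  by apply: le_trans (l1norm_le_enorm _) _; rewrite ler_wpM2l.
have l2 : l1norm (z.2 - z'.2) <= s * e.
  by apply: le_trans (l1norm_le_enorm _) _; rewrite ler_wpM2l.
rewrite (_ : _ - _ = A z.2 * (ev g z.1 - ev g z'.1) + (A z.2 - A z'.2) * ev g z'.1
  - (ev n z.1 * ev g z.1 - ev n z'.1 * ev g z'.1)); last by ring.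
apply: le_trans (ler_normB _ _) _.
have le1 : `|A z.2 * (ev g z.1 - ev g z'.1)| <= a0 * (D * `|g| * (s * e)).
  rewrite normrM ler_pM ?A_le//; apply: le_trans (rkhs_eval_lipschitz _ _ _) _ => //.
  by rewrite ler_wpM2l// mulr_ge0.
have le2 : `|(A z.2 - A z'.2) * ev g z'.1| <= a1 * (s * e) * (D * `|g|).
  rewrite normrM ler_pM ?rkhs_eval_norm_le//; apply: le_trans (A_lip _ _ _ _) _ => //.
  by rewrite ler_wpM2l.
have le3 : `|ev n z.1 * ev g z.1 - ev n z'.1 * ev g z'.1| <=
    D * (`|n| * `|g|) * (s * e).
  apply: le_trans (rkhs_mul_lipschitz _ _ _ _) _ => //.
  by rewrite ler_wpM2l// !mulr_ge0.
have le12 := ler_normD (A z.2 * (ev g z.1 - ev g z'.1)) ((A z.2 - A z'.2) * ev g z'.1).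
rewrite [leRHS](_ : _ = a0 * (D * `|g| * (s * e)) + a1 * (s * e) * (D * `|g|)
   + D * (`|n| * `|g|) * (s * e)); last by ring.
by rewrite lerD// (le_trans le12)// lerD.
Qed.

End LipschitzRKHS.

(** * Stability of the minimizer in the measure and in the point *)

Theorem theorem2p4 (R : realType) (d : nat) (X : set 'rV[R]_d)
    (k : 'rV[R]_d -> 'rV[R]_d -> R) (H : rkhs X k)
    (A : 'rV[R]_d -> R) (lambda : R) :
  (0 < d)%N ->
  open X ->
  convex_set (X : set (convex_lmodType 'rV[R]_d)) ->
  symmetric_kernel X k ->
  posdef_kernel X k ->
  kC2 X k ->
  (forall x, X x -> 0 < k x x) ->
  (Dk_sq X k < +oo)%E ->
  C1space X A ->
  0 < lambda ->
  forall (x y : 'rV[R]_d) (mu nu : probability (@borel2 R d) R),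
  X x -> X y -> P2 X mu -> P2 X nu ->
  let D := Dk X k in
  let normA := fine (C1norm X A) in
  let C1 := (D / lambda ^+ 2 + 1 / lambda) * d%:R * D ^+ 2 * normA in
  let C2 := Num.sqrt d%:R / lambda * D ^+ 2 * normA in
  (`|rkhs_eval (minimizer H A lambda mu) x
     - rkhs_eval (minimizer H A lambda nu) y|%:E
   <= C1%:E * W1 mu nu + (C2 * enorm (x - y))%:E)%E.
Proof.
move=> d0 oX cX _ _ k2 kpos kfin A1 lam0 x y mu nu Xx Xy [muXX _] [nuXX _].
have [a0 [a1 [a00 a10 normAE A_le dA_le]]] := C1norm_bounds d0 Xx A1.
rewrite normAE; pose D := Dk X k; pose normA := a0 + a1.
pose C1 := (D / lambda ^+ 2 + 1 / lambda) * d%:R * D ^+ 2 * normA.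
pose C2 := Num.sqrt d%:R / lambda * D ^+ 2 * normA.
change (`|rkhs_eval (minimizer H A lambda mu) x
     - rkhs_eval (minimizer H A lambda nu) y|%:E
   <= C1%:E * W1 mu nu + (C2 * enorm (x - y))%:E)%E.
have D0 : 0 <= D by exact: Dk_ge0.
(* Follows from 0 < k(x,x) <= D^2, and allows dividing by [K] below. *)
have Dgt0 : 0 < D.
  have [_ _ kD] := Dk_bounds (Ordinal d0) (Ordinal d0) kfin Xx Xx.
  have : 0 < D ^+ 2.
    by apply: lt_le_trans (kpos x Xx) (le_trans (ler_norm _) kD).
  by apply: contraTT; rewrite -!leNgt => D_le0; rewrite (le_anti (_ : D <= 0 <= D)) ?D_le0// expr0n.
pose s : R := Num.sqrt d%:R.
have s1 : 1 <= s by rewrite -sqrtr1 ler_wsqrtr// ler1n.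
have sd : s ^+ 2 = d%:R by rewrite sqr_sqrtr.
have A_lip u v : X u -> X v -> `|A u - A v| <= a1 * l1norm (u - v).
  move=> Xu Xv; apply: (increment_le oX cX) => //.
  by move=> z i Xz; case: A1 => + _; exact.
have A_cont u : X u -> {for u, continuous A}.
  exact: (lipschitz_l1_continuous oX a10 A_lip).
have ev_le := @rkhs_eval_norm_le _ _ _ _ H d0 kfin.
have ev_cont := @rkhs_eval_continuous _ _ _ _ H oX cX k2 kfin.
have norm_le (rho : probability (@borel2 R d) R) : rho (X `*` X) = 1%E ->
    `|minimizer H A lambda rho| <= a0 * D / lambda.
  move=> rhoXX; rewrite ler_pdivlMr// mulrC.
  exact: (minimizer_norm_le oX lam0 D0 a00 A_le A_cont ev_le ev_cont).
have diff_le := minimizer_diff_le oX lam0 D0 a00 A_le A_cont ev_le ev_cont muXX nuXX.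
have := norm_le mu muXX; have := norm_le nu nuXX.
move: diff_le; set m := minimizer H A lambda mu; set n := minimizer H A lambda nu.
set phi := fun z => _ => diff_le n_le m_le.
pose g := m - n.
have W1_ge0 : (0 <= W1 mu nu)%E.
  apply/ereal_infP => _ [dO [Om [P [U [V [_ _ ->]]]]]].
  by apply: integral_ge0 => w _; rewrite lee_fin enorm2_ge0.
have C1_ge0 : 0 <= C1.
  have lam1 := ltW lam0; rewrite /C1 (mulr_ge0 _ (addr_ge0 a00 a10))//.
  by rewrite mulr_ge0 ?sqr_ge0// mulr_ge0// addr_ge0// divr_ge0// exprn_ge0.
(* [W1] may be infinite and [0 * +oo = 0], so [C1 = 0] is covered only because
   [normA = 0] forces both minimizers to vanish. *)
have stability : ((D * `|g|)%:E <= C1%:E * W1 mu nu)%E.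
  have [g0|g0] := eqVneq g 0.
    by rewrite g0 normr0 mulr0 mule_ge0.
  have gp : 0 < `|g| by rewrite normr_gt0.
  have normAp : 0 < normA.
    rewrite lt_neqAle addr_ge0// andbT eq_sym; apply/eqP => A0.
    have a0E : a0 = 0 by move: A0; rewrite /normA; lra.
    move: m_le n_le; rewrite a0E !mul0r !normr_le0 => /eqP m0 /eqP n0.
    by move: g0; rewrite /g m0 n0 subrr eqxx.
  (* [K] times |g| is a Lipschitz constant of [phi]: in [residual_lipschitz], |n| is at most
     [a0 * D / lambda], and [a0] is enlarged to [normA]. *)
  pose K := s * D * (normA * (1 + D / lambda)).
  have K0 : 0 < K.
    have s0 : 0 < s by exact: lt_le_trans s1.
    by rewrite !mulr_gt0// ltr_pwDl// divr_ge0// ltW.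
  (* Dividing by K|g| cancels one factor |g| and leaves a lower bound on the cost of each coupling,
     which passes to the infimum. *)
  have W1_le : ((lambda * `|g| / K)%:E <= W1 mu nu)%E.
    apply/ereal_infP => _ [dO [Om [P [U [V [UP VP ->]]]]]].
    have phi_lip (z z' : @borel2 R d) : (X `*` X) z -> (X `*` X) z' ->
        `|phi z - phi z'| <= K * `|g| * enorm2 ((z : _ * _) - z').
      move=> Xz Xz'; apply: le_trans
        (residual_lipschitz d0 oX cX k2 kfin n g a00 a10 A_le A_lip Xz Xz') _.
      rewrite ler_wpM2r ?enorm2_ge0// ler_wpM2r// ler_wpM2l ?mulr_ge0 ?sqrtr_ge0//.
      apply: le_trans (_ : a0 + a1 + a0 * D / lambda <= _); first by rewrite lerD2l.
      rewrite mulrDr mulr1 lerD2l mulrA ler_wpM2r ?invr_ge0 ?(ltW lam0)//.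
      by rewrite ler_wpM2r// lerDl.
    have bphi : bounded_measurable (X `*` X : set (@borel2 R d)) phi.
      apply: bounded_measurableM.
        apply: bounded_measurableB.
          exact: (bounded_measurable_label oX A_le A_cont).
        exact: (bounded_measurable_eval oX ev_le ev_cont).
      exact: (bounded_measurable_eval oX ev_le ev_cont).
    have cb := @coupling_bound _ _ _ _ _ P U V mu nu (X `*` X : set (@borel2 R d)) phi
      (fun z z' => enorm2 ((z : _ * _) - z')) (K * `|g|)
      (measurable_square oX) muXX nuXX bphi UP VP (mulr_gt0 K0 gp)
      (fun _ _ => enorm2_ge0 _) phi_lip.
    have Kg := mulr_gt0 K0 gp; rewrite -(lee_pdivrMl _ _ Kg) in cb.
    apply: le_trans cb; rewrite -EFinM lee_fin ler_pdivlMl//.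
    apply: le_trans diff_le.
    by rewrite le_eqVlt; apply/orP; left; apply/eqP; field; rewrite gt_eqF.
  apply: (@le_trans _ _ ((D * K / lambda)%:E * W1 mu nu)%E).
    rewrite (_ : D * `|g| = D * K / lambda * (lambda * `|g| / K)); last first.
      by field; rewrite !gt_eqF.
    rewrite EFinM; apply: lee_wpmul2l => //.
    by rewrite lee_fin (divr_ge0 (mulr_ge0 D0 (ltW K0)) (ltW lam0)).
  apply: lee_wpmul2r => //; rewrite lee_fin.
  (* The two constants differ by one factor [s], so [1 <= s] turns the square root of d into d. *)
  rewrite (_ : C1 = s ^+ 2 * (D ^+ 2 * normA * (1 + D / lambda) / lambda)); last first.
    by rewrite /C1 sd; field; rewrite gt_eqF.
  rewrite (_ : D * K / lambda = s * (D ^+ 2 * normA * (1 + D / lambda) / lambda)); last first.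
    by rewrite /K; field; rewrite gt_eqF.
  apply: ler_wpM2r.
    by rewrite !mulr_ge0// ?addr_ge0 ?invr_ge0 ?divr_ge0// ltW.
  by rewrite expr2 ler_peMr// (le_trans _ s1).
have ev_g : `|rkhs_eval m x - rkhs_eval n x| <= D * `|g|.
  by rewrite -rkhs_evalB//; exact: ev_le.
have ev_n : `|rkhs_eval n x - rkhs_eval n y| <= C2 * enorm (x - y).
  apply: le_trans (rkhs_eval_lipschitz oX cX k2 kfin n Xx Xy) _.
  (* The bound on |n| enters together with the comparison of [l1norm] and [enorm]; enlarging [a0] to
     [normA] then gives [C2]. *)
  apply: (@le_trans _ _ (D * (a0 * D / lambda) * (s * enorm (x - y)))).
    by rewrite ler_pM ?mulr_ge0 ?l1norm_ge0 ?l1norm_le_enorm// ler_wpM2l.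
  rewrite (_ : C2 * _ = D * (normA * D / lambda) * (s * enorm (x - y))); last first.
    by rewrite /C2 -/s; field; rewrite gt_eqF.
  rewrite ler_wpM2r ?mulr_ge0 ?sqrtr_ge0// ler_wpM2l// ler_wpM2r ?invr_ge0 ?(ltW lam0)//.
  by rewrite ler_wpM2r// lerDl.
(* Triangle inequality through n(x): the measure changes at the point [x], then the point moves with
   [nu] fixed. *)
apply: (@le_trans _ _ ((D * `|g|)%:E + (C2 * enorm (x - y))%:E)%E).
  rewrite -EFinD lee_fin -(subrK (rkhs_eval n x) (rkhs_eval m x)) -addrA.
  by apply: le_trans (ler_normD _ _) _; exact: lerD.
by rewrite leeD2r.
Qed.
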